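(* Let $\mu$ be an MFG solution such that $\sum_{x\in\mathbb{X}}\tilde\mu(x)=C$ with $C\in[\tilde c,\tilde C]$, and such that $\tilde F(x,\tilde\mu)\ge 0$ for every $x\in\mathbb{X}$ with $\tilde\mu(x)=C_{max}$. Let $\boldsymbol{w}^*\in\mathbb{R}^n$ be the column vector with $\boldsymbol{w}^*_i=\tilde\mu(X^i)$. Then $\boldsymbol{w}^*$ is the unique solution of the optimization problem $$\max_{\boldsymbol{w}\in\mathbb{R}^n}\; -\tfrac12\,\sigma\,\boldsymbol{w}^\top\mathbf{C}\,\boldsymbol{w}+\lambda\,\boldsymbol{E}[W]^\top\boldsymbol{w}$$ subject to $\sum_{i=1}^n w_i=C$ and $0\le w_i\le C_{max}$ for $i=1,\dots,n$.
   Context: Setting. Let $0<\tilde c\le\tilde C$, and let $\mathbb{C}=\{c^1,\dots,c^k\}$ be uniformly spaced points partitioning $[\tilde c,\tilde C]$, in increasing order, with $c^1=\tilde c$ and $c^k=\tilde C$ ($k=1$ if $\tilde c=\tilde C$). Let $\mathbb{X}=\{X^1,\dots,X^n\}$ be distinct points of a bounded domain in $\mathbb{R}^2$ (a uniform grid). The action space is the finite set $A=\mathbb{C}\times\mathbb{X}$. For each $x\in\mathbb{X}$, $W(x)$ is a square-integrable real random variable (capacity factor at $x$), all defined on a common probability space. Let $C_{max}>0$, let $\lambda$ be a real constant (revenue scaling coefficient) and $\sigma>0$ a constant (clustering penalty coefficient). $\mathbf{C}$ is the $n\times n$ matrix with $\mathbf{C}_{i,j}=\mathrm{Cov}(W(X^i),W(X^j))$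 (not to be confused with the scalar $C$ or the set $\mathbb{C}$), and $\boldsymbol{E}[W]\in\mathbb{R}^n$ is the column vector with entries $\boldsymbol{E}[W]_i=\mathbb{E}[W(X^i)]$. For a probability measure $\mu$ on $A$ define $\tilde\mu(x)=\sum_{c\in\mathbb{C}}c\,\mu(c,x)$ for $x\in\mathbb{X}$, $$\tilde F(x,\tilde\mu)=\lambda\,\mathbb{E}[W(x)]-\sigma\sum_{x'\in\mathbb{X}}\mathrm{Cov}(W(x),W(x'))\,\tilde\mu(x'),\qquad F((c,x),\mu)=c\,\tilde F(x,\tilde\mu).$$ MFG solution. A probability measure $\mu$ on $A$ is an MFG solution if, with $X_{max}=\{x\in\mathbb{X}:\tilde\mu(x)=C_{max}\}$: (i) $\tilde\mu(x)\le C_{max}$ for all $x\in\mathbb{X}$; (ii) for any $x\in X_{max}$ and $c\in\mathbb{C}$ with $\mu(c,x)>0$: $F((c,x),\mu)\ge F((c',y),\mu)$ for all $(c',y)\in A$ with $\tilde\mu(y)<C_{max}$, and $F((c,x),\mu)\ge F((c',x),\mu)$ for all $c'\in\mathbb{C}$ with $c'<c$; (iii) for any $x\in\mathbb{X}\setminus X_{max}$ and $c\in\mathbb{C}$ with $\mu(c,x)>0$: $F((c,x),\mu)=\sup_{c'\in\mathbb{C},\,y'\in\mathbb{X}\setminus X_{max}}F((c',y'),\mu)$.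
   Formalization: Uniqueness of the solution is asserted only when the covariance matrix is positive definite (it fails, for example, for W = 0 with two sites); that w* is a solution is proved under the original hypotheses. *)

(* Defs.v *)
From HB Require Import structures.
From mathcomp Require Import all_boot all_order all_algebra.
From mathcomp Require Import all_classical all_reals all_analysis.
Set Implicit Arguments.
Unset Strict Implicit.
Unset Printing Implicit Defensive.
Import Order.TTheory GRing.Theory Num.Theory.
Import numFieldNormedType.Exports.
Local Open Scope classical_set_scope.
Local Open Scope ring_scope.

(* The finite sets of capacities {c^1 < ... < c^k} and of sites {X^1, ..., X^n}
   are given by injective enumerations indexed by 'I_k and 'I_n. Accordingly an
   action (c^j, X^i) is the pair (j, i), a probability measure on the set of
   actions is its mass function, and functions on the set of sites are
   functions on 'I_n. *)

(* Strict monotonicity forces k = 1 when a = b. *)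
Definition uniform_points (R : realType) (a b : R) (k : nat) (c : 'I_k -> R) :=
  [/\ (0 < k)%N,
      forall i j : 'I_k, (i < j)%N -> c i < c j,
      exists h : R, forall i : 'I_k, c i = a + i%:R * h
    & forall i : 'I_k, i.+1 = k -> c i = b].

Definition is_proba (R : realType) (A : finType) (mu : A -> R) :=
  (forall a, 0 <= mu a) /\ \sum_a mu a = 1.

(* Matrix of covariances and vector of expectations of the family W; [fine]
   is the identity here when the W i are square-integrable. *)
Definition cov_mx d (T : measurableType d) (R : realType)
    (P : probability T R) (n : nat) (W : 'I_n -> T -> R) : 'M[R]_n :=
  \matrix_(i, j) fine (covariance P (W i) (W j)).

Definition mean_vec d (T : measurableType d) (R : realType)
    (P : probability T R) (n : nat) (W : 'I_n -> T -> R) : 'cV[R]_n :=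
  \col_i fine (expectation P (W i)).

Definition tilde (R : realType) (k n : nat) (c : 'I_k -> R)
    (mu : 'I_k * 'I_n -> R) (i : 'I_n) : R :=
  \sum_(j < k) c j * mu (j, i).

Definition Ftilde d (T : measurableType d) (R : realType)
    (P : probability T R) (lambda sigma : R) (n : nat) (W : 'I_n -> T -> R)
    (m : 'I_n -> R) (i : 'I_n) : R :=
  lambda * fine (expectation P (W i))
  - sigma * \sum_(i' < n) fine (covariance P (W i) (W i')) * m i'.

Definition Freward d (T : measurableType d) (R : realType)
    (P : probability T R) (lambda sigma : R) (k n : nat) (c : 'I_k -> R)
    (W : 'I_n -> T -> R) (mu : 'I_k * 'I_n -> R) (a : 'I_k * 'I_n) : R :=
  c a.1 * Ftilde P lambda sigma W (tilde c mu) a.2.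

Definition MFG_solution d (T : measurableType d) (R : realType)
    (P : probability T R) (lambda sigma Cmax : R) (k n : nat) (c : 'I_k -> R)
    (W : 'I_n -> T -> R) (mu : 'I_k * 'I_n -> R) : Prop :=
  let F := Freward P lambda sigma c W mu in
  let Xmax := [set x : 'I_n | tilde c mu x = Cmax] in
  [/\ is_proba mu,
      forall x, tilde c mu x <= Cmax,
      forall x j, Xmax x -> 0 < mu (j, x) ->
        (forall j' y, tilde c mu y < Cmax -> F (j', y) <= F (j, x)) /\
        (forall j', c j' < c j -> F (j', x) <= F (j, x))
    & forall x j, ~ Xmax x -> 0 < mu (j, x) ->
        F (j, x) = sup [set F a | a in [set a : 'I_k * 'I_n | ~ Xmax a.2]]].

Definition objective (R : realType) (n : nat) (lambda sigma : R)
    (K : 'M[R]_n) (e w : 'cV[R]_n) : R :=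
  - (2^-1 * sigma * (w^T *m K *m w) 0 0) + lambda * (e^T *m w) 0 0.

Definition feasible (R : realType) (n : nat) (C Cmax : R) (w : 'cV[R]_n) :=
  \sum_(i < n) w i 0 = C /\ forall i, 0 <= w i 0 <= Cmax.

Definition is_optimal (R : realType) (n : nat) (lambda sigma C Cmax : R)
    (K : 'M[R]_n) (e w : 'cV[R]_n) : Prop :=
  feasible C Cmax w /\
  forall v, feasible C Cmax v ->
    objective lambda sigma K e v <= objective lambda sigma K e w.

Definition posdef_mx (R : realType) (n : nat) (K : 'M[R]_n) : Prop :=
  K^T = K /\ forall v : 'cV[R]_n, v != 0 -> 0 < (v^T *m K *m v) 0 0.

(* Main.v *)
(* The objective is quadratic and, its quadratic part being minus a variance,
   concave; its gradient at w* is Ftilde.  The equilibrium conditions say that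
   no positive mass sits at a site whose marginal reward Ftilde is below that of
   an unsaturated site.  Moving mass from w* to another feasible point therefore
   cannot have positive first-order effect, so w* is optimal by concavity, and
   the unique optimum when the covariance matrix is positive definite. *)

Require Import Defs.
From HB Require Import structures.
From mathcomp Require Import all_boot all_order all_algebra.
From mathcomp Require Import all_classical all_reals all_analysis.
From mathcomp Require Import ring lra.
Set Implicit Arguments.
Unset Strict Implicit.
Unset Printing Implicit Defensive.
Import Order.TTheory GRing.Theory Num.Theory.
Import numFieldNormedType.Exports.
Local Open Scope classical_set_scope.
Local Open Scope ring_scope.

(** [fine] respects products and sums only of finite values; square integrability makes the
    covariances finite, here and in the additive version. *)
Lemma fine_covarianceZl d (T : measurableType d) (R : realType)
    (P : probability T R) (a : R) (X Z : T -> R) :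
  X \in Lfun P 2%:E -> Z \in Lfun P 2%:E ->
  fine (covariance P (a \o* X) Z) = a * fine (covariance P X Z).
Proof.
move=> X2 Z2; have Pfin := fin_num_measure P _ measurableT.
have [X1 Z1] := (Lfun_subset12 Pfin X2, Lfun_subset12 Pfin Z2).
have XZ1 := Lfun2_mul_Lfun1 X2 Z2.
by rewrite covarianceZl// fineM// covariance_fin_num.
Qed.

Lemma fine_covarianceDl d (T : measurableType d) (R : realType)
    (P : probability T R) (X Y Z : T -> R) :
  X \in Lfun P 2%:E -> Y \in Lfun P 2%:E -> Z \in Lfun P 2%:E ->
  fine (covariance P (X \+ Y) Z) =
    fine (covariance P X Z) + fine (covariance P Y Z).
Proof.
move=> X2 Y2 Z2; have Pfin := fin_num_measure P _ measurableT.
rewrite covarianceDl// fineD// covariance_fin_num ?Lfun2_mul_Lfun1//;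
  exact: Lfun_subset12.
Qed.

Lemma Lfun2_scale d (T : measurableType d) (R : realType)
    (P : probability T R) (a : R) (X : T -> R) :
  X \in Lfun P 2%:E -> a \o* X \in Lfun P 2%:E.
Proof. by move=> X2; rewrite Lfun_scale// ler1n. Qed.

Lemma Lfun2_sum d (T : measurableType d) (R : realType)
    (P : probability T R) (I : Type) (s : seq I) (W : I -> T -> R) :
  (forall i, W i \in Lfun P 2%:E) -> \sum_(i <- s) W i \in Lfun P 2%:E.
Proof. by move=> W2; rewrite rpred_sum// lee1n. Qed.

Lemma fine_covariance_suml d (T : measurableType d) (R : realType)
    (P : probability T R) (I : Type) (s : seq I) (a : I -> R)
    (W : I -> T -> R) (Z : T -> R) :
  (forall i, W i \in Lfun P 2%:E) -> Z \in Lfun P 2%:E ->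
  fine (covariance P (\sum_(i <- s) a i \o* W i) Z) =
    \sum_(i <- s) a i * fine (covariance P (W i) Z).
Proof.
move=> W2 Z2; elim: s => [|i s IHs].
  by rewrite !big_nil -[0]/(cst 0) covariance_cst_l.
rewrite !big_cons -IHs -fine_covarianceZl//.
apply: fine_covarianceDl => //; first exact: Lfun2_scale.
by apply: Lfun2_sum => j; exact: Lfun2_scale.
Qed.

(** The summand has the shape obtained by expanding a covariance of two linear combinations one
    argument at a time. *)
Lemma quad_formE (R : comPzRingType) (n : nat) (K : 'M[R]_n) (v w : 'cV[R]_n) :
  (v^T *m K *m w) 0 0 = \sum_i \sum_j v i 0 * (w j 0 * K i j).
Proof.
rewrite mxE exchange_big/=; apply: eq_bigr => j _.
rewrite mxE mulr_suml; apply: eq_bigr => i _.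
by rewrite mxE -mulrA [K i j * _]mulrC.
Qed.

Lemma tr_cov_mx d (T : measurableType d) (R : realType)
    (P : probability T R) (n : nat) (W : 'I_n -> T -> R) :
  (cov_mx P W)^T = cov_mx P W.
Proof. by apply/matrixP => i j; rewrite !mxE covarianceC. Qed.

(* v^T Cov(W) v is the variance of \sum_i v_i W_i. *)
Lemma cov_mx_ge0 d (T : measurableType d) (R : realType)
    (P : probability T R) (n : nat) (W : 'I_n -> T -> R) (v : 'cV[R]_n) :
  (forall i, W i \in Lfun P 2%:E) -> 0 <= (v^T *m cov_mx P W *m v) 0 0.
Proof.
move=> W2; pose S : T -> R := \sum_i v i 0 \o* W i.
have S2 : S \in Lfun P 2%:E by apply: Lfun2_sum => i; exact: Lfun2_scale.
suff -> : (v^T *m cov_mx P W *m v) 0 0 = fine (variance P S).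
  by rewrite fine_ge0// variance_ge0.
rewrite quad_formE /variance fine_covariance_suml//; apply: eq_bigr => i _.
rewrite covarianceC fine_covariance_suml// mulr_sumr; apply: eq_bigr => j _.
by rewrite mxE covarianceC.
Qed.

(** The second-order expansion at [w] is exact because the objective is quadratic; symmetry of [K]
    gives the gradient its single term in [K]. *)
Lemma objective_taylor (R : realType) (n : nat) (lambda sigma : R)
    (K : 'M[R]_n) (e w v : 'cV[R]_n) : K^T = K ->
  objective lambda sigma K e v = objective lambda sigma K e w
    + \sum_i (lambda * e i 0 - sigma * \sum_j K i j * w j 0) * (v i 0 - w i 0)
    - 2^-1 * sigma * ((v - w)^T *m K *m (v - w)) 0 0.
Proof.
move=> KT; rewrite /objective.
have [h ->] : exists h, v = w + h by exists (v - w); rewrite addrC subrK.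
have -> : w + h - w = h by rewrite addrAC subrr add0r.
have -> : \sum_i (lambda * e i 0 - sigma * \sum_j K i j * w j 0) *
    ((w + h) i 0 - w i 0)
    = lambda * (e^T *m h) 0 0 - sigma * (h^T *m K *m w) 0 0.
  rewrite quad_formE mxE !mulr_sumr -sumrB; apply: eq_bigr => i _.
  rewrite -mulr_sumr !mxE [w i 0 + _ - _]addrAC subrr add0r.
  under [in RHS]eq_bigr => j _ do rewrite mulrC.
  by ring.
(* The two cross terms agree by symmetry of [K], so together they cancel the factor 1/2. *)
have qC : (w^T *m K *m h) 0 0 = (h^T *m K *m w) 0 0.
  have -> : h^T *m K *m w = (w^T *m K *m h)^T.
    by rewrite !trmx_mul trmxK KT mulmxA.
  by rewrite [RHS]mxE.
rewrite [(w + h)^T]linearD/= !mulmxDl !mulmxDr.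
have addE (A B : 'M[R]_1) : (A + B) 0 0 = A 0 0 + B 0 0 by rewrite mxE.
rewrite !addE qC.
by field.
Qed.

(** Passing from [w] to [v] takes mass from indices with [0 < w i] and adds it at indices with
    [w j < b], where [g] is no larger. *)
Lemma sum_exchange_le0 (R : realDomainType) (n : nat) (b : R)
    (g w v : 'I_n -> R) :
  0 < \sum_i w i -> \sum_i v i = \sum_i w i ->
  (forall i, 0 <= w i <= b) -> (forall i, 0 <= v i <= b) ->
  (forall i j, 0 < w i -> w j < b -> g j <= g i) ->
  \sum_i g i * (v i - w i) <= 0.
Proof.
move=> wsum_gt0 vw w_bnd v_bnd g_mono.
have [i0 wi0 i0_min] : exists2 i, 0 < w i & forall j, 0 < w j -> g i <= g j.
  have [/existsP[i1 wi1]|/existsPn w_le0] := boolP [exists i, 0 < w i].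
    case: (@arg_minP _ _ _ i1 (fun i => 0 < w i) g wi1) => i wi i_min.
    by exists i.
  by move: wsum_gt0; rewrite ltNge sumr_le0// => i _; rewrite leNgt w_le0.
(* [m] is the multiplier of the constraint on the total mass. *)
pose m := g i0.
(* Equal total masses allow a constant to be subtracted from [g]; after this each summand is
   nonpositive on its own. *)
have -> : \sum_i g i * (v i - w i) = \sum_i (g i - m) * (v i - w i).
  under [RHS]eq_bigr => i _ do rewrite mulrBl.
  by rewrite sumrB -mulr_sumr (sumrB _ _ v) vw subrr mulr0 subr0.
apply: sumr_le0 => i _.
have /andP[v0 vb] := v_bnd i; have /andP[w0 wb] := w_bnd i.
(* Below the cap [g i <= m], with equality if [w i > 0], while [v i >= w i] if [w i = 0]. At the cap
   the signs are reversed. *)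
have [wi_lt|wi_ge] := ltP (w i) b.
  have gi_le := g_mono _ _ wi0 wi_lt.
  have [wi_gt0|wi_le0] := ltP 0 (w i).
    by rewrite (_ : g i = m) ?subrr ?mul0r//; apply/le_anti; rewrite gi_le i0_min.
  by rewrite mulr_le0_ge0 ?subr_le0 ?subr_ge0//; exact: le_trans v0.
have [wi_gt0|wi_le0] := ltP 0 (w i).
  by rewrite mulr_ge0_le0 ?subr_ge0 ?i0_min// subr_le0; exact: le_trans wi_ge.
(* Here [b <= w i <= 0], so the bounds force [v i = w i = 0]. *)
by rewrite (_ : v i - w i = 0) ?mulr0//; lra.
Qed.

(** Supplies the monotonicity hypothesis of [sum_exchange_le0], with [Ftilde] as [g] and [Cmax] as
    [b]. *)
Lemma MFG_Ftilde_le d (T : measurableType d) (R : realType)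
    (P : probability T R) (lambda sigma Cmax : R) (k n : nat) (c : 'I_k -> R)
    (W : 'I_n -> T -> R) (mu : 'I_k * 'I_n -> R) (x y : 'I_n) :
  (forall j, 0 < c j) -> MFG_solution P lambda sigma Cmax c W mu ->
  0 < tilde c mu x -> tilde c mu y < Cmax ->
  Ftilde P lambda sigma W (tilde c mu) y <=
    Ftilde P lambda sigma W (tilde c mu) x.
Proof.
move=> c_gt0 [[mu_ge0 _] _ sat unsat] x_gt0 y_lt.
have [j mujx] : exists j, 0 < mu (j, x).
  apply/existsP; apply: contraTT x_gt0 => /existsPn mu_le0.
  rewrite -leNgt sumr_le0// => j _.
  by rewrite mulr_ge0_le0 ?(ltW (c_gt0 j))// leNgt mu_le0.
pose F := Freward P lambda sigma c W mu.
(* Comparing the two sites at the same capacity, the factor [c j] cancels. *)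
suff : F (j, y) <= F (j, x) by rewrite ler_pM2l.
have [x_max|x_nmax] := pselect (tilde c mu x = Cmax).
  by have [/(_ j y y_lt)] := sat _ _ x_max mujx.
rewrite [leRHS]unsat//; apply: ub_le_sup; last first.
  by exists (j, y) => //= y_max; move: y_lt; rewrite y_max ltxx.
(* A real [sup] dominates its set only if the set is bounded above; as there are finitely many
   actions, this crude bound suffices. *)
exists (\sum_a `|F a|) => _ [a _ <-].
rewrite (bigD1 a)//= (le_trans (ler_norm _))// lerDl.
exact: sumr_ge0.
Qed.

Theorem theorem3 (R : realType) (d : measure_display) (T : measurableType d)
    (P : probability T R)
    (ctilde Ctilde : R) (hc0 : 0 < ctilde) (hcC : ctilde <= Ctilde)
    (k : nat) (c : 'I_k -> R) (hc : uniform_points ctilde Ctilde c)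
    (n : nat) (D : set 'rV[R]_2) (hD : bounded_set D)
    (X : 'I_n -> 'rV[R]_2) (hX : injective X) (hXD : forall i, D (X i))
    (W : 'rV[R]_2 -> T -> R) (hW : forall i, W (X i) \in Lfun P 2%:E)
    (Cmax lambda sigma : R) (hCmax : 0 < Cmax) (hsigma : 0 < sigma)
    (mu : 'I_k * 'I_n -> R)
    (hmu : MFG_solution P lambda sigma Cmax c (W \o X) mu)
    (C : R) (hC : ctilde <= C <= Ctilde)
    (hsum : \sum_(i < n) tilde c mu i = C)
    (hF : forall i, tilde c mu i = Cmax ->
            0 <= Ftilde P lambda sigma (W \o X) (tilde c mu) i) :
  let K := cov_mx P (W \o X) in
  let e := mean_vec P (W \o X) in
  let wstar := \col_(i < n) tilde c mu i in
  is_optimal lambda sigma C Cmax K e wstar /\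
  (posdef_mx K ->
     forall w, is_optimal lambda sigma C Cmax K e w -> w = wstar).
Proof.
move=> K e w.
have [k_gt0 c_mono [h cE] _] := hc.
have c_gt0 j : 0 < c j.
  pose j0 := Ordinal k_gt0.
  have cj0 : c j0 = ctilde by rewrite cE mul0r addr0.
  have [->|j_neq0] := eqVneq j j0; first by rewrite cj0.
  by rewrite (lt_trans hc0)// -cj0 c_mono// lt0n.
have W2 i : (W \o X) i \in Lfun P 2%:E := hW i.
have [[mu_ge0 _] w_le _ _] := hmu.
have w_feas : feasible C Cmax w.
  split=> [|i]; first by rewrite -hsum; apply: eq_bigr => i _; rewrite mxE.
  rewrite mxE w_le andbT sumr_ge0// => j _.
  by rewrite mulr_ge0// ltW.
have C_gt0 : 0 < C by case/andP: hC => /(lt_le_trans hc0).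
have first_order v : feasible C Cmax v ->
    \sum_i (lambda * e i 0 - sigma * \sum_j K i j * w j 0) * (v i 0 - w i 0)
      <= 0.
  move=> [v_sum v_bnd]; apply: (@sum_exchange_le0 _ _ Cmax).
  - by case: w_feas => ->.
  - by case: w_feas => ->.
  - by case: w_feas.
  - by [].
  (* The gradient of the objective at [w] is the marginal reward. *)
  - have gE i : lambda * e i 0 - sigma * \sum_j K i j * w j 0 =
        Ftilde P lambda sigma (W \o X) (tilde c mu) i.
      rewrite /Ftilde mxE; congr (_ - _ * _).
      by apply: eq_bigr => j _; rewrite !mxE.
    move=> i j; rewrite !gE !mxE; exact: MFG_Ftilde_le.
have KT : K^T = K := tr_cov_mx P (W \o X).
split=> [|[_ K_pos] v [v_feas v_max]].
  split=> // v /first_order fo; rewrite (objective_taylor _ _ _ w v KT).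
  rewrite -addrA gerDl subr_le0 (le_trans fo)// mulr_ge0 ?cov_mx_ge0//.
  by rewrite mulr_ge0 ?invr_ge0// ltW.
(* If [v] differed from [w], the quadratic term of the expansion at [w] would be strictly negative
   and [v] would do worse than [w]. *)
apply/eqP; rewrite -subr_eq0; apply: contraT => /K_pos K_gt0.
move: (v_max w w_feas); rewrite (objective_taylor _ _ _ w v KT).
rewrite -addrA lerDl subr_ge0 leNgt (le_lt_trans (first_order v v_feas))//.
by rewrite !mulr_gt0 ?invr_gt0.
Qed.
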